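(* For every integer $j \geq 10$ there is no positive integer $n$ with $p^2(n,j) = 3$; that is, no positive integer can be expressed as the sum of exactly $j$ positive squares in exactly $3$ ways when $j \ge 10$.
   Context: For positive integers $k, j$ and a nonnegative integer $n$, $p^k(n,j)$ denotes the number of partitions of $n$ into exactly $j$ parts, each part a positive $k$-th power; equivalently, the number of multisets $\{x_1,\dots,x_j\}$ of positive integers (order of summands ignored) with $x_1^k+\cdots+x_j^k = n$. *)

(* Defs.v *)
From mathcomp Require Import all_boot.

Set Implicit Arguments.
Unset Strict Implicit.
Unset Printing Implicit Defensive.

(* [power_partition k n j s]: s is a partition of n into exactly j positive
   k-th powers, given by the multiset of the bases of its parts. A multiset is
   represented by its unique weakly increasing listing. *)
Definition power_partition (k n j : nat) (s : seq nat) : bool :=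
  [&& size s == j, sorted leq s, all (fun x => 0 < x) s
    & \sum_(x <- s) x ^ k == n].

(* The number p^k(n, j). Bases are drawn from 'I_n.+1 only to make the count
   finite; [power_partition_countP] shows that for k > 0 nothing is lost. *)
Definition power_partition_count (k n j : nat) : nat :=
  #|[set t : j.-tuple 'I_n.+1 |
      power_partition k n j [seq val i | i <- t]]|.

Lemma power_partition_le (k n j : nat) (s : seq nat) (x : nat) :
  0 < k -> power_partition k n j s -> x \in s -> x <= n.
Proof.
move=> k0 /and4P[_ _ /allP pos /eqP <-] xs.
rewrite (big_rem x) //=; apply: leq_trans (leq_addr _ _).
by rewrite -{1}[x]expn1 leq_pexp2l // pos.
Qed.

Lemma power_partition_countP (k n j : nat) : 0 < k ->
  exists S : seq (seq nat), [/\ uniq S, size S = power_partition_count k n j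
    & forall s, (s \in S) = power_partition k n j s].
Proof.
move=> k0; pose A := [set t : j.-tuple 'I_n.+1 |
  power_partition k n j [seq val i | i <- t]].
pose f (t : j.-tuple 'I_n.+1) := [seq val i | i <- t].
exists [seq f t | t <- enum A]; split.
- rewrite map_inj_uniq ?enum_uniq // => t u /(inj_map val_inj).
  exact: val_inj.
- by rewrite size_map -cardE.
move=> s; apply/mapP/idP => [[t tA ->]|ps]; first by move: tA; rewrite mem_enum inE.
have es : [seq val i | i <- [seq (inord x : 'I_n.+1) | x <- s]] = s.
  rewrite -map_comp -[RHS]map_id; apply/eq_in_map => x xs /=.
  by rewrite inordK // ltnS (power_partition_le k0 ps).
have sz : size [seq (inord x : 'I_n.+1) | x <- s] == j.
  by rewrite size_map; case/and4P: ps.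
by exists (Tuple sz); rewrite /f ?mem_enum ?inE /= es.
Qed.

(* Main.v *)
(* Subtracting 1 from each square, a partition of n into j positive squares is a
   partition of m = n - j into at most j parts of the form x^2 - 1 with x > 1.
   For m < 1188 a computation shows that either there are at most two such
   partitions whatever j is, or there are at least four with at most 10 parts.
   For m >= 1188, Lagrange's theorem gives a representation of any integer above
   169 by five positive squares (169 itself being a sum of one, two, three or
   four positive squares), hence for each y = 2, ..., 32 a partition of m into at
   most 10 parts that contains y^2 - 1. Three partitions with at most 10 parts
   cannot account for all these 31 values. *)

Require Import Defs.
From mathcomp Require Import all_boot all_order all_algebra.
From mathcomp Require Import zify ring.

Set Implicit Arguments.
Unset Strict Implicit.
Unset Printing Implicit Defensive.

(** * Lagrange's four-square theorem *)

Section FourSquares.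
Import Order.TTheory GRing.Theory Num.Theory.
Local Open Scope ring_scope.

Definition four_squares (n : int) : Prop :=
  exists a b c d : int, n = a ^+ 2 + b ^+ 2 + c ^+ 2 + d ^+ 2.

(** Euler's identity: the witnesses are the coordinates of the second quaternion times the conjugate
    of the first. *)
Lemma four_squaresM (m n : int) :
  four_squares m -> four_squares n -> four_squares (m * n).
Proof.
move=> [a [b [c [d ->]]]] [x [y [z [t ->]]]].
exists (a * x + b * y + c * z + d * t), (a * y - b * x + c * t - d * z),
  (a * z - c * x + d * y - b * t), (a * t - d * x + b * z - c * y).
ring.
Qed.

Lemma balanced_division (m : nat) (x : int) : (0 < m)%N ->
  exists k y : int, [/\ x = m%:Z * k + y, - m%:Z < 2 * y & 2 * y <= m%:Z].
Proof.
move=> m0; have e := divz_eq x m.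
have r0 : 0 <= (x %% m)%Z by apply: modz_ge0; lia.
have r1 : (x %% m)%Z < m%:Z by apply: ltz_pmod; lia.
move: (x %% m)%Z (x %/ m)%Z e r0 r1 => r q e r0 r1.
have [h|h] := lerP (2 * r) m%:Z.
  by exists q, r; split; lia.
by exists (q + 1), (r - m%:Z); split; lia.
Qed.

Lemma balanced_sqr_le (m : nat) (y : int) : - m%:Z < 2 * y -> 2 * y <= m%:Z ->
  4 * y ^+ 2 <= m%:Z ^+ 2.
Proof. by move=> h1 h2; nia. Qed.

(** The strict lower bound rules out [2 * y = - m]. *)
Lemma balanced_sqr_eq (m : nat) (y : int) : - m%:Z < 2 * y -> 2 * y <= m%:Z ->
  4 * y ^+ 2 = m%:Z ^+ 2 -> 2 * y = m%:Z.
Proof. by move=> h1 h2 h3; nia. Qed.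

(* Write the numbers whose squares sum to [m * p] as [m * k + y] with balanced
   remainders [y]. Then
   [y1 ^+ 2 + .. + y4 ^+ 2 = m * r] with [0 < r < m], and all four coordinates
   of Euler's product of the two quadruples are divisible by [m]; the quotients,
   given explicitly at the end, represent [r * p]. *)
Lemma four_squares_descent (p m : nat) : prime p -> (0 < m < p)%N ->
  four_squares (m * p)%:Z -> four_squares p%:Z.
Proof.
move=> pp; elim/ltn_ind: m => m IH /andP[m0 mp] [a [b [c [d E]]]].
have [m1|m1] := leqP m 1.
  have m_1 : m = 1%N by lia.
  by exists a, b, c, d; rewrite -E m_1 mul1n.
have ndiv (k : int) : p%:Z <> m%:Z * k.
  move=> e; have : (m %| p)%N.
    by apply/dvdnP; exists `|k|%N; move/(congr1 absz): e; rewrite abszM mulnC.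
  by case/primeP: pp => _ h /h /orP[] /eqP; lia.
have [k1 [y1 [ea la ua]]] := balanced_division a m0.
have [k2 [y2 [eb lb ub]]] := balanced_division b m0.
have [k3 [y3 [ec lc uc]]] := balanced_division c m0.
have [k4 [y4 [ed ld ud]]] := balanced_division d m0.
pose X := a * k1 + b * k2 + c * k3 + d * k4.
pose K := k1 ^+ 2 + k2 ^+ 2 + k3 ^+ 2 + k4 ^+ 2.
pose r := p%:Z - 2 * X + m%:Z * K.
rewrite PoszM in E.
have Er : y1 ^+ 2 + y2 ^+ 2 + y3 ^+ 2 + y4 ^+ 2 = m%:Z * r.
  have -> : y1 = a - m%:Z * k1 by rewrite ea; ring.
  have -> : y2 = b - m%:Z * k2 by rewrite eb; ring.
  have -> : y3 = c - m%:Z * k3 by rewrite ec; ring.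
  have -> : y4 = d - m%:Z * k4 by rewrite ed; ring.
  rewrite [LHS](_ : _ = (a ^+ 2 + b ^+ 2 + c ^+ 2 + d ^+ 2)
    - 2 * m%:Z * X + m%:Z ^+ 2 * K); last by rewrite /X /K; ring.
  by rewrite -E /r; ring.
have S1 := balanced_sqr_le la ua; have S2 := balanced_sqr_le lb ub.
have S3 := balanced_sqr_le lc uc; have S4 := balanced_sqr_le ld ud.
have r_ge0 : 0 <= r.
  by rewrite -(@pmulr_rge0 _ m%:Z) // -Er !addr_ge0 // sqr_ge0.
have r_lem : r <= m%:Z.
  by rewrite -(@ler_pM2l _ m%:Z) // -Er -expr2; clear -S1 S2 S3 S4; lia.
(* If [r = 0], all remainders vanish and [m ^ 2] divides [m * p], so [m] divides the prime [p]
   although [1 < m < p]. *)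
have r_neq0 : r != 0.
  apply/eqP => r0; rewrite r0 mulr0 in Er.
  have N1 := sqr_ge0 y1; have N2 := sqr_ge0 y2.
  have N3 := sqr_ge0 y3; have N4 := sqr_ge0 y4.
  have z (y : int) : y ^+ 2 = 0 -> y = 0 by move/eqP; rewrite sqrf_eq0 => /eqP.
  have Z1 : y1 = 0 by apply: z; clear -N1 N2 N3 N4 Er; lia.
  have Z2 : y2 = 0 by apply: z; clear -N1 N2 N3 N4 Er; lia.
  have Z3 : y3 = 0 by apply: z; clear -N1 N2 N3 N4 Er; lia.
  have Z4 : y4 = 0 by apply: z; clear -N1 N2 N3 N4 Er; lia.
  apply: (ndiv K); apply: (@mulfI _ m%:Z); first by clear -m0; lia.
  by rewrite E ea eb ec ed Z1 Z2 Z3 Z4 /K; ring.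
(* If [r = m], every remainder is [m / 2]; the four squares again sum to a multiple of [m ^ 2]. *)
have r_neqm : r != m%:Z.
  apply/eqP => rm; rewrite rm -expr2 in Er.
  have H1 : 2 * y1 = m%:Z.
    by apply: balanced_sqr_eq => //; clear -S1 S2 S3 S4 Er; lia.
  have H2 : 2 * y2 = m%:Z.
    by apply: balanced_sqr_eq => //; clear -S1 S2 S3 S4 Er; lia.
  have H3 : 2 * y3 = m%:Z.
    by apply: balanced_sqr_eq => //; clear -S1 S2 S3 S4 Er; lia.
  have H4 : 2 * y4 = m%:Z.
    by apply: balanced_sqr_eq => //; clear -S1 S2 S3 S4 Er; lia.
  apply: (ndiv (1 + k1 + k2 + k3 + k4 + K)).
  apply: (@mulfI _ m%:Z); first by clear -m0; lia.
  have e2 : y2 = y1 by clear -H1 H2; lia.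
  have e3 : y3 = y1 by clear -H1 H3; lia.
  have e4 : y4 = y1 by clear -H1 H4; lia.
  by rewrite E ea eb ec ed e2 e3 e4 -H1 /K; ring.
have er : r = `|r|%N%:Z by clear -r_ge0; lia.
have rm : (0 < `|r| < m)%N by clear -r_ge0 r_lem r_neq0 r_neqm; lia.
apply: (IH `|r|%N); [by case/andP: rm | by clear -rm mp; lia |].
rewrite PoszM -er.
exists (p%:Z - X), (a * k2 - b * k1 + c * k4 - d * k3),
  (a * k3 - c * k1 + d * k2 - b * k4), (a * k4 - d * k1 + b * k3 - c * k2).
transitivity (p%:Z ^+ 2 - 2 * p%:Z * X + (m%:Z * p%:Z) * K).
  by rewrite /r; ring.
by rewrite E /X /K; ring.
Qed.

Lemma sqr_absz (x : int) : (`|x| ^ 2)%N%:Z = x ^+ 2.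
Proof. by rewrite -abszX gez0_abs ?sqr_ge0. Qed.

End FourSquares.

(** The prime [p] divides [i - k] or [i + k], and both are at most [2 * h < p]. *)
Lemma sqr_mod_inj (p h i k : nat) : prime p -> p = h.*2.+1 -> i <= h -> k <= h ->
  i ^ 2 = k ^ 2 %[mod p] -> i = k.
Proof.
move=> pp ph; wlog ki : i k / k <= i.
  by move=> W hi hk e; case: (leqP k i) => [|/ltnW] ki; [|symmetry]; apply: W.
move=> hi hk /eqP; rewrite eqn_mod_dvd ?leq_sqr // subn_sqr Euclid_dvdM //.
case/orP=> /dvdnP[[|q]] ; lia.
Qed.

(* Pigeonhole: for [i <= h] the [h + 1] residues of [i ^ 2] and the [h + 1]
   residues of [- 1 - i ^ 2] cannot all be distinct modulo [2 * h + 1]. *)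
Lemma prime_dvd_sum_sqr (p : nat) : prime p -> odd p ->
  exists m a b : nat, 0 < m < p /\ a ^ 2 + b ^ 2 + 1 = m * p.
Proof.
move=> pp op; have ph : p = (p./2).*2.+1 by have := odd_double_half p; lia.
set h := p./2 in ph.
have p0 : 0 < p := prime_gt0 pp.
pose A := [seq i ^ 2 %% p | i <- iota 0 h.+1].
pose B := [seq p.-1 - i ^ 2 %% p | i <- iota 0 h.+1].
have lt i : i ^ 2 %% p < p by rewrite ltn_mod.
have uA : uniq A.
  rewrite map_inj_in_uniq ?iota_uniq // => i k; rewrite !mem_iota => hi hk.
  by apply: (sqr_mod_inj pp ph); lia.
have uB : uniq B.
  rewrite map_inj_in_uniq ?iota_uniq // => i k; rewrite !mem_iota => hi hk e.
  apply: (sqr_mod_inj pp ph); [lia|lia|].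
  by have := lt i; have := lt k; lia.
have [/hasP[x /mapP[i]]|dis] := boolP (has (mem A) B).
  rewrite mem_iota => /andP[_ hi] -> /mapP[k]; rewrite mem_iota => /andP[_ hk] e.
  have : p %| i ^ 2 + k ^ 2 + 1.
    apply/dvdnP; exists (i ^ 2 %/ p + k ^ 2 %/ p + 1).
    rewrite !mulnDl {1}(divn_eq (i ^ 2) p) {1}(divn_eq (k ^ 2) p) -e.
    by have := lt i; lia.
  case/dvdnP => m em; exists m, i, k; split=> //.
  (* Bounding both squares by [h ^ 2] gives [m * p < p * p]. *)
  have ih : i ^ 2 <= h ^ 2 by rewrite leq_sqr; clear -hi; lia.
  have kh : k ^ 2 <= h ^ 2 by rewrite leq_sqr; clear -hk; lia.
  have hp : h ^ 2 + h ^ 2 + 1 < p * p by have := prime_gt1 pp; rewrite ph; clear; nia.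
  have m0 : 0 < m by case: (m) em => //; rewrite addn1.
  rewrite m0 -(ltn_pmul2r p0) -em; clear -ih kh hp; lia.
have : size (A ++ B) <= size (iota 0 p).
  apply: uniq_leq_size; first by rewrite cat_uniq uA uB dis.
  move=> x; rewrite mem_cat mem_iota => /orP[] /mapP[i _ ->]; have := lt i; lia.
by rewrite size_cat !size_map !size_iota; lia.
Qed.

(** Multiplicativity reduces the claim to primes; for odd [p] the descent starts from a multiple
    [a ^ 2 + b ^ 2 + 1] of [p]. *)
Lemma lagrange_four_squares (n : nat) :
  exists a b c d : nat, n = a ^ 2 + b ^ 2 + c ^ 2 + d ^ 2.
Proof.
suff [a [b [c [d e]]]] : four_squares n.
  by exists `|a|%N, `|b|%N, `|c|%N, `|d|%N; move: e; rewrite -!sqr_absz; lia.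
elim/ltn_ind: n => n IH.
have [n1|n1] := leqP n 1.
  by exists (Posz n), 0%R, 0%R, 0%R; case: n n1 {IH} => [|[|]].
have pp := pdiv_prime n1; set p := pdiv n in pp.
have Fp : four_squares p.
  have [op|ep] := boolP (odd p); last first.
    have -> : p = 2.
      by case/primeP: pp => _ h; have := h 2; rewrite dvdn2 ep => /(_ isT) /eqP.
    by exists 1%R, 1%R, 0%R, 0%R.
  have [m [a [b [hm e]]]] := prime_dvd_sum_sqr pp op.
  apply: (four_squares_descent pp hm); rewrite -e.
  by exists (Posz a), (Posz b), 1%R, 0%R; lia.
have /dvdnP[q e] := pdiv_dvd n; rewrite -/p in e.
rewrite {1}e PoszM; apply: four_squaresM => //; apply: IH.
have := prime_gt1 pp; nia.
Qed.

(** * Sums of exactly five positive squares *)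

Lemma square_as_positive_squares (a : nat) :
  exists u : seq nat,
    [/\ size u = (0 < a), all (ltn 0) u & sumn [seq x ^ 2 | x <- u] = a ^ 2].
Proof.
case: a => [|a]; first by exists [::].
by exists [:: a.+1]; rewrite /= addn0.
Qed.

Lemma five_positive_squares (n : nat) : 169 < n ->
  exists u : seq nat,
    [/\ size u = 5, all (ltn 0) u & sumn [seq x ^ 2 | x <- u] = n].
Proof.
move=> hn; have [a [b [c [d e]]]] := lagrange_four_squares (n - 169).
have [ua [sa pa ea]] := square_as_positive_squares a.
have [ub [sb pb eb]] := square_as_positive_squares b.
have [uc [sc pc ec]] := square_as_positive_squares c.
have [ud [sd pd ed]] := square_as_positive_squares d.
pose u := ua ++ ub ++ uc ++ ud.
have pu : all (ltn 0) u by rewrite !all_cat pa pb pc pd.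
have eu : sumn [seq x ^ 2 | x <- u] = n - 169.
  by rewrite !map_cat !sumn_cat ea eb ec ed e; lia.
(* Zero squares were dropped, and [n - 169 > 0] keeps [u] nonempty. *)
have su : 0 < size u <= 4.
  apply/andP; split; last first.
    rewrite !size_cat sa sb sc sd.
    by case: (0 < a) (0 < b) (0 < c) (0 < d) => -[] [] [].
  by case: (u) eu => //=; lia.
suff [v [sv pv ev]] : exists v : seq nat, [/\ size v = 5 - size u, all (ltn 0) v
    & sumn [seq x ^ 2 | x <- v] = 169].
  exists (u ++ v); rewrite size_cat all_cat pu pv map_cat sumn_cat eu ev sv.
  by split=> //; lia.
case: (size u) su => [|[|[|[|[|]]]]] // _.
- by exists [:: 10; 8; 2; 1].
- by exists [:: 12; 4; 3].
- by exists [:: 12; 5].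
- by exists [:: 13].
Qed.

(** * Partitions with the parts equal to 1 removed *)

(* Subtracting 1 from every square makes parts equal to 1 invisible: partitions
   of [m + j] into j positive squares correspond to the [reduced m] sequences of
   size at most j. *)
Definition reduced (m : nat) (t : seq nat) : bool :=
  [&& sorted leq t, all (ltn 1) t & sumn [seq x ^ 2 - 1 | x <- t] == m].

Definition pad (j : nat) (t : seq nat) : seq nat := nseq (j - size t) 1 ++ t.

Lemma pad_partition (j m : nat) (t : seq nat) : size t <= j -> reduced m t ->
  power_partition 2 (m + j) j (pad j t).
Proof.
move=> st /and3P[so gt1 /eqP sm].
have gt0 : all (fun x => 0 < x) t by apply: sub_all gt1 => x /=; lia.
apply/and4P; split.
- by rewrite size_cat size_nseq subnK.
- rewrite sorted_pairwise; last exact: leq_trans.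
  rewrite pairwise_cat -!sorted_pairwise; try exact: leq_trans.
  rewrite so andbT; apply/andP; split.
    by apply/allrelP => x y /nseqP[-> _] /(allP gt0).
  by elim: (j - size t) => // -[|k].
- by rewrite all_cat gt0 andbT all_nseq orbT.
rewrite big_cat /= big_nseq iter_addn_0 mul1n -sm.
have -> : \sum_(x <- t) x ^ 2 = sumn [seq x ^ 2 - 1 | x <- t] + size t.
  elim: t gt0 {st so gt1 sm} => [|x t IH] /=; first by rewrite big_nil.
  case/andP=> x0 /IH e; rewrite big_cons e.
  have : 0 < x ^ 2 by rewrite expn_gt0 x0.
  lia.
by apply/eqP; lia.
Qed.

Lemma filter_pad (j m : nat) (t : seq nat) : reduced m t ->
  [seq x <- pad j t | 1 < x] = t.
Proof.
case/and3P=> _ gt1 _; rewrite filter_cat filter_nseq.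
exact/all_filterP.
Qed.

(** Discarding the 1s loses nothing, since [j] determines how many there were. *)
Lemma partition_reduced (n j : nat) (s : seq nat) : power_partition 2 n j s ->
  let t := [seq x <- s | 1 < x] in
  [/\ j <= n, size t <= j, reduced (n - j) t & s = pad j t].
Proof.
case/and4P=> /eqP ss so gt0 /eqP sn /=.
have tr := leq_trans.
have [cnt sm] : size [seq x <- s | 1 < x] <= size s /\
    n = sumn [seq x ^ 2 - 1 | x <- s & 1 < x] + size s.
  rewrite -sn; elim: s gt0 {ss so sn} => [|x s IH] /=; first by rewrite big_nil.
  case/andP=> x0 /IH[e1 e2]; rewrite big_cons e2.
  have : 0 < x ^ 2 by rewrite expn_gt0 x0.
  have [x1|x1] := ltnP 1 x => /=; first by lia.
  have -> : x = 1 by lia.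
  by move: e1; rewrite exp1n; lia.
rewrite -ss; split=> //; first lia.
  by apply/and3P; split; [exact: sorted_filter | exact: filter_all | apply/eqP; lia].
apply: (sorted_eq leq_trans anti_leq) => //.
  rewrite sorted_pairwise // pairwise_cat -!sorted_pairwise //.
  rewrite sorted_filter // andbT; apply/andP; split.
    by apply/allrelP => x y /nseqP[-> _]; rewrite mem_filter => /andP[/ltnW].
  by elim: (_ - _) => // -[|k].
rewrite -(perm_filterC (fun x => 1 < x) s) perm_catC.
apply/permPl; apply: perm_catr.
rewrite [X in perm_eq X](_ : _ = nseq (size s - size [seq x <- s | 1 < x]) 1) //.
elim: s gt0 {ss so sn cnt sm} => //= x s IH /andP[x0 /IH ->].
have : size [seq x <- s | 1 < x] <= size s by rewrite size_filter count_size.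
by have [x1|x1] := ltnP 1 x => /= h; rewrite ?subSS // subSn //=; congr cons; lia.
Qed.

(** * Computation for [m < 1188] *)

Fixpoint enum_reduced (fuel lo m : nat) : seq (seq nat) :=
  if m == 0 then [:: [::]] else
  if fuel is f.+1 then
    flatten [seq [seq y :: t | t <- enum_reduced f y (m - (y ^ 2 - 1))]
            | y <- iota lo m & y ^ 2 - 1 <= m]
  else [::].

Lemma enum_reduced_complete (fuel lo m : nat) (t : seq nat) :
  1 < lo -> m <= fuel -> path leq lo t -> sumn [seq x ^ 2 - 1 | x <- t] = m ->
  t \in enum_reduced fuel lo m.
Proof.
elim: fuel lo m t => [|f IH] lo m t lo1 mf.
  case: t => [|x t] /= => [_ <- //|/andP[lx _]].
  have : 2 ^ 2 <= x ^ 2 by rewrite leq_sqr; lia.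
  lia.
case: t => [|x t] /= => [_ <- //|/andP[lx pt] e].
(* This bound puts [x] in the range [iota lo m] and makes the remainder fit the smaller fuel. *)
have x4 : 2 * x <= x ^ 2 by rewrite -mulnn leq_mul2r; lia.
have /negPf-> : m != 0 by lia.
apply/flattenP; exists [seq x :: t | t <- enum_reduced f x (m - (x ^ 2 - 1))].
  apply: (map_f (fun y => [seq y :: t | t <- enum_reduced f y (m - (y ^ 2 - 1))])).
  by rewrite mem_filter mem_iota; apply/andP; split; lia.
by apply: map_f; apply: IH => //; lia.
Qed.

Lemma reduced_enum (m : nat) (t : seq nat) :
  reduced m t -> t \in enum_reduced m 2 m.
Proof.
case/and3P=> so gt1 /eqP; apply: enum_reduced_complete => //.
by case: t so gt1 => //= x t -> /andP[->].
Qed.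

(* Depth-first search, largest part first, for four reduced sequences of size at
   most k; its output is checked, not proved correct. *)
Fixpoint search (fuel x m k : nat) (acc : seq nat) (res : seq (seq nat)) :=
  if 3 < size res then res else
  if m == 0 then acc :: res else
  if fuel is f.+1 then
    if (k == 0) || (x < 2) then res else
    let w := x ^ 2 - 1 in
    search f x.-1 m k acc
      (if w <= m then search f x (m - w) k.-1 (x :: acc) res else res)
  else res.

(** For [m < 1188] no part reaches 35, as [35 ^ 2 - 1 = 1224]. Each nested call of [search] lowers
    [x] or [k] by one, so fuel 46 exceeds the depth [35 + 10]. *)
Definition four_or_few (m : nat) : bool :=
  let S := search 46 35 m 10 [::] [::] in
  if size S == 4 then uniq S && all (fun t => (size t <= 10) && reduced m t) S
  else size (enum_reduced m 2 m) <= 2.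

Lemma four_or_few_small : all four_or_few (iota 0 1188).
Proof. by vm_compute. Qed.

(** * Large [m] and the conclusion *)

(* The bound makes [m + 6 - y ^ 2 > 169]: of the 10 squares summing to [m + 10],
   one is [y ^ 2], four are 1 and five come from [five_positive_squares]. *)
Lemma reduced_with_part (m y : nat) : 1187 < m -> 1 < y < 33 ->
  exists t : seq nat, [/\ size t <= 10, reduced m t & y \in t].
Proof.
move=> hm hy; have y2 : y ^ 2 <= 32 ^ 2 by rewrite leq_sqr; lia.
have y2' : 32 ^ 2 = 1024 by [].
have [|u [su pu eu]] := @five_positive_squares (m + 6 - y ^ 2); first by lia.
pose s := sort leq (y :: nseq 4 1 ++ u).
have ps : power_partition 2 (m + 10) 10 s.
  apply/and4P; split.
  - by rewrite size_sort /= su.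
  - by apply: sort_sorted; exact: leq_total.
  - by rewrite all_sort /= pu andbT; lia.
  rewrite (perm_big (y :: nseq 4 1 ++ u)) ?perm_sort //= !big_cons !exp1n.
  by rewrite sumnE big_map in eu; rewrite eu; apply/eqP; lia.
have [_ st rt _] := partition_reduced ps.
exists [seq x <- s | 1 < x]; split=> //; first by rewrite addnK in rt.
by rewrite mem_filter mem_sort inE eqxx; case/andP: hy => ->.
Qed.

Theorem theorem1p2 (j : nat) (hj : 10 <= j) :
  ~ exists n : nat, 0 < n /\ power_partition_count 2 n j = 3.
Proof.
move=> [n [_ c3]].
have [S [uS sS memS]] := power_partition_countP n j (isT : 0 < 2).
rewrite c3 in sS.
pose red (s : seq nat) := [seq x <- s | 1 < x].
have redP s : s \in S -> [/\ j <= n, size (red s) <= j,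
    reduced (n - j) (red s) & s = pad j (red s)].
  by rewrite memS; apply: partition_reduced.
have jn : j <= n.
  by case: (S) sS redP => // s S' _ /(_ s (mem_head _ _)) [].
pose m := n - j; pose T := [seq red s | s <- S].
have uT : uniq T.
  rewrite map_inj_in_uniq // => s1 s2 /redP[_ _ _ e1] /redP[_ _ _ e2] e.
  by rewrite e1 e2 e.
have sT : size T = 3 by rewrite size_map.
(* Here [10 <= j] enters: such a [t] can be padded with 1s to [j] parts. *)
have memT t : size t <= 10 -> reduced m t -> t \in T.
  move=> st rt; apply/mapP; exists (pad j t); last by rewrite /red (filter_pad _ rt).
  by rewrite memS -(subnK jn); apply: pad_partition => //; apply: leq_trans hj.
have [m_small|m_large] := ltnP m 1188.
  have /(allP four_or_few_small) : m \in iota 0 1188 by rewrite mem_iota.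
  rewrite /four_or_few; set L := search _ _ _ _ _ _.
  case: eqP => [sL /andP[uL /allP hL]|_ few].
    have : size L <= size T.
      by apply: uniq_leq_size => // t /hL /andP[]; apply: memT.
    by rewrite sL sT.
  have : size T <= size (enum_reduced m 2 m).
    by apply: uniq_leq_size => // _ /mapP[s /redP[_ _ rs _] ->]; apply: reduced_enum.
  by rewrite sT leqNgt ltnS few.
(* [V] has at most 30 entries but contains all 31 values from 2 to 32. *)
pose V := flatten [seq t <- T | size t <= 10].
have : size (iota 2 31) <= size V.
  apply: uniq_leq_size => [|y]; first exact: iota_uniq.
  rewrite mem_iota => hy; have [t [st rt yt]] := reduced_with_part m_large hy.
  by apply/flattenP; exists t; rewrite ?mem_filter ?st ?memT.
have : size V <= 10 * size T.
  rewrite /V; elim: T {uT sT memT V} => //= t T IH.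
  by case: ifP => //= st; rewrite ?size_cat; lia.
by rewrite sT size_iota; lia.
Qed.
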